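(* Let $\{(y^k,z^k)\}_{k\ge 0}$ be any sequence generated by the Bregman alternating minimization algorithm (described in the context) applied to $\Phi(y,z)=f(y)+H(y,z)+g(z)$, with convex differentiable functions $\phi^k,\psi^k$ having Lipschitz gradients. Then for every $k\ge 0$, $$\Phi(y^{k+1},z^{k+1})\le \Phi(y^{k+1},z^{k})\le \Phi(y^{k},z^{k}).$$
   Context: Setting. Let $f:\mathbb{R}^{N_1}\to(-\infty,+\infty]$, $g:\mathbb{R}^{N_2}\to(-\infty,+\infty]$ and $H:\mathbb{R}^{N_1}\times\mathbb{R}^{N_2}\to(-\infty,+\infty]$ be proper closed (lower semicontinuous) functions, not assumed convex, with $H$ finite and continuously differentiable on (an open set containing) $\mathrm{dom}(f)\times\mathrm{dom}(g)$. Put $\Phi(y,z)=f(y)+H(y,z)+g(z)$. There are constants $L_1,L_2$ such that $\|\nabla_y H(\overline y,z)-\nabla_y H(y,z)\|_2\le L_1\|\overline y-y\|_2$ for all $y,\overline y\in\mathrm{dom}(f)$, $z\in\mathrm{dom}(g)$, and $\|\nabla_z H(y,\overline z)-\nabla_z H(y,z)\|_2\le L_2\|\overline z-z\|_2$ for all $y\in\mathrm{dom}(f)$, $z,\overline z\in\mathrm{dom}(g)$. Bregman distance. For a convex differentiable function $\phi$, $B_\phi(x,y):=\phi(x)-\phi(y)-\langle\nabla\phi(y),x-y\rangle$. Algorithm (Bregman alternating minimization). For each $k\ge0$ let $\phi^k:\mathbb{R}^{N_1}\to\mathbb{R}$ and $\psi^k:\mathbb{R}^{N_2}\to\mathbb{R}$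 be convex differentiable functions with Lipschitz continuous gradients. Starting from $(y^0,z^0)\in\mathrm{dom}(f)\times\mathrm{dom}(g)$, a sequence is generated by the algorithm if for all $k\ge0$ $$y^{k+1}\in\arg\min_{y}\ H(y,z^k)+f(y)+B_{\phi^k}(y,y^k),\qquad z^{k+1}\in\arg\min_{z}\ H(y^{k+1},z)+g(z)+B_{\psi^k}(z,z^k)$$ (the minimizers are assumed to exist). *)

(* Defs.v *)
From HB Require Import structures.
From mathcomp Require Import all_boot all_order all_algebra.
From mathcomp Require Import all_classical all_reals all_analysis.
Set Implicit Arguments.
Unset Strict Implicit.
Unset Printing Implicit Defensive.
Import Order.TTheory GRing.Theory Num.Theory.
Import numFieldNormedType.Exports.
Local Open Scope classical_set_scope.
Local Open Scope ring_scope.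

(* The norm carried by 'rV[R]_n in the library is the sup norm (it induces the
   usual topology and differentiability); Lipschitz bounds are stated with the
   Euclidean norm below. *)
Definition dotp (R : realType) (n : nat) (u v : 'rV[R]_n) : R :=
  \sum_(i < n) u 0 i * v 0 i.

Definition norm2 (R : realType) (n : nat) (u : 'rV[R]_n) : R :=
  Num.sqrt (dotp u u).

Definition grad (R : realType) (n : nat) (h : 'rV[R]_n -> R) (x : 'rV[R]_n) :
    'rV[R]_n :=
  \row_i 'D_(delta_mx 0 i) h x.

Definition edom (R : realType) (T : Type) (h : T -> \bar R) : set T :=
  [set x | (h x < +oo)%E].

(* Codomain (-oo, +oo] and not identically +oo. *)
Definition proper_fun (R : realType) (T : Type) (h : T -> \bar R) : Prop :=
  (forall x, (-oo < h x)%E) /\ edom h !=set0.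

Definition argmin (R : realType) (T : Type) (h : T -> \bar R) : set T :=
  [set x | forall x', (h x <= h x')%E].

Definition bregman (R : realType) (n : nat) (phi : 'rV[R]_n -> R)
    (x y : 'rV[R]_n) : R :=
  phi x - phi y - dotp (grad phi y) (x - y).

Definition kernel_fun (R : realType) (n : nat) (phi : 'rV[R]_n -> R) : Prop :=
  [/\ convex_function [set: 'rV[R]_n] phi,
      forall x, differentiable phi x
    & exists L : R, forall x y,
        norm2 (grad phi x - grad phi y) <= L * norm2 (x - y)].

(* The partial gradients are taken of the real part [fine] of H, hence are
   meaningful only at points near which H is finite. *)
Definition grad_y (R : realType) (N1 N2 : nat)
    (H : 'rV[R]_N1 * 'rV[R]_N2 -> \bar R)
    (p : 'rV[R]_N1 * 'rV[R]_N2) : 'rV[R]_N1 :=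
  grad (fun y => fine (H (y, p.2))) p.1.

Definition grad_z (R : realType) (N1 N2 : nat)
    (H : 'rV[R]_N1 * 'rV[R]_N2 -> \bar R)
    (p : 'rV[R]_N1 * 'rV[R]_N2) : 'rV[R]_N2 :=
  grad (fun z => fine (H (p.1, z))) p.2.

Definition finite_C1_on (R : realType) (N1 N2 : nat)
    (H : 'rV[R]_N1 * 'rV[R]_N2 -> \bar R)
    (U : set ('rV[R]_N1 * 'rV[R]_N2)) : Prop :=
  forall p, U p ->
    [/\ H p \is a fin_num,
        differentiable (fine \o H) p,
        {for p, continuous (grad_y H)}
      & {for p, continuous (grad_z H)}].

Definition objective (R : realType) (N1 N2 : nat)
    (f : 'rV[R]_N1 -> \bar R) (g : 'rV[R]_N2 -> \bar R)
    (H : 'rV[R]_N1 * 'rV[R]_N2 -> \bar R)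
    (y : 'rV[R]_N1) (z : 'rV[R]_N2) : \bar R :=
  (f y + H (y, z) + g z)%E.

Definition bregman_altmin (R : realType) (N1 N2 : nat)
    (f : 'rV[R]_N1 -> \bar R) (g : 'rV[R]_N2 -> \bar R)
    (H : 'rV[R]_N1 * 'rV[R]_N2 -> \bar R)
    (phi : nat -> 'rV[R]_N1 -> R)
    (psi : nat -> 'rV[R]_N2 -> R)
    (y : nat -> 'rV[R]_N1) (z : nat -> 'rV[R]_N2) : Prop :=
  [/\ edom f (y 0%N), edom g (z 0%N)
    & forall k : nat,
        argmin (fun y' => H (y', z k) + f y' + (bregman (phi k) y' (y k))%:E)%E
          (y k.+1) /\
        argmin (fun z' => H (y k.+1, z') + g z'
                          + (bregman (psi k) z' (z k))%:E)%E
          (z k.+1)].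

(* Main.v *)
Require Import Defs.
From HB Require Import structures.
From mathcomp Require Import all_boot all_order all_algebra.
From mathcomp Require Import all_classical all_reals all_analysis.
From mathcomp Require Import ring.
Import Order.TTheory GRing.Theory Num.Theory.
Import numFieldNormedType.Exports.
Local Open Scope classical_set_scope.
Local Open Scope ring_scope.

(** The differential is linear, so expanding [v] in the standard basis recovers the partial
    derivatives. This links the coordinate gradient in [bregman] to directional derivatives. *)
Lemma dotp_grad (R : realType) (n : nat) (h : 'rV[R]_n -> R) (x v : 'rV[R]_n) :
  differentiable h x -> dotp (grad h x) v = 'D_v h x.
Proof.
move=> dh; rewrite deriveE// [in RHS](row_sum_delta v) linear_sum.
by apply: eq_bigr => i _; rewrite linearZ /= mxE deriveE// mulrC.
Qed.

Lemma convex_function_segment (R : realType) (V : normedModType R)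
    (h : V -> R) (x y : V) (t : R) :
  convex_function [set: V] h -> 0 <= t -> t <= 1 ->
  h (t *: (x - y) + y) - h y <= t * (h x - h y).
Proof.
move=> ch t0 t1.
have hxy : h (t *: x + (1 - t) *: y) <= t * h x + (1 - t) * h y.
  by have := ch (Itv01 t0 t1) x y; rewrite !inE; apply.
have -> : t *: (x - y) + y = t *: x + (1 - t) *: y.
  by rewrite scalerBr scalerBl scale1r -addrA [- _ + y]addrC.
rewrite lerBlDr; apply: le_trans hxy _.
suff -> : t * h x + (1 - t) * h y = t * (h x - h y) + h y by [].
ring.
Qed.

(** By the chord inequality, every difference quotient from [y] towards [x] with step in [(0, 1]] is
    at most [h x - h y], and the bound passes to the limit. *)
Lemma convex_derive_le (R : realType) (V : normedModType R) (h : V -> R)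
    (x y : V) :
  convex_function [set: V] h -> derivable h y (x - y) ->
  'D_(x - y) h y <= h x - h y.
Proof.
(* The chord bound is available only for positive steps, so the two-sided limit is replaced by the
   right-hand one. *)
move=> ch dh; rewrite /derive cvg_at_rightE//.
apply: limr_le.
  apply: cvgP; apply: cvg_trans dh; apply: cvg_app.
  by apply: within_subset => t /= t0; rewrite gt_eqF.
near=> t.
have t0 : 0 < t by [].
rewrite /= /GRing.scale/= mulrC ler_pdivrMr// mulrC.
by apply: convex_function_segment => //; exact: ltW.
Unshelve. all: by end_near. Qed.

Lemma bregman_ge0 (R : realType) (n : nat) (h : 'rV[R]_n -> R)
    (x y : 'rV[R]_n) :
  convex_function [set: 'rV[R]_n] h -> differentiable h y ->
  0 <= bregman h x y.
Proof.
move=> ch dh; rewrite /bregman subr_ge0 dotp_grad//.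
by apply: convex_derive_le => //; exact: diff_derivable.
Qed.

Lemma bregmanxx (R : realType) (n : nat) (h : 'rV[R]_n -> R) (x : 'rV[R]_n) :
  bregman h x x = 0.
Proof.
rewrite /bregman (subrr (h x)) (subrr x) sub0r /dotp big1 ?oppr0// => i _.
by rewrite [X in _ * X]mxE mulr0.
Qed.

Lemma argmin_bregman_le (R : realType) (n : nat) (F : 'rV[R]_n -> \bar R)
    (h : 'rV[R]_n -> R) (x y : 'rV[R]_n) :
  convex_function [set: 'rV[R]_n] h -> differentiable h y ->
  argmin (fun x' => F x' + (bregman h x' y)%:E)%E x -> (F x <= F y)%E.
Proof.
(* The competitor is the centre [y] itself, where the Bregman penalty is zero; at [x] the penalty
   can only increase the value. *)
move=> ch dh /(_ y); rewrite bregmanxx adde0; apply: le_trans.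
by rewrite leeDl// lee_fin bregman_ge0.
Qed.

Theorem theorem1 (R : realType) (N1 N2 : nat)
    (f : 'rV[R]_N1 -> \bar R) (g : 'rV[R]_N2 -> \bar R)
    (H : 'rV[R]_N1 * 'rV[R]_N2 -> \bar R) (L1 L2 : R)
    (proper_f : proper_fun f) (closed_f : lower_semicontinuous f)
    (proper_g : proper_fun g) (closed_g : lower_semicontinuous g)
    (proper_H : proper_fun H) (closed_H : lower_semicontinuous H)
    (C1_H : exists U : set ('rV[R]_N1 * 'rV[R]_N2),
        [/\ open U, edom f `*` edom g `<=` U & finite_C1_on H U])
    (lip_y : forall (y y' : 'rV[R]_N1) (z : 'rV[R]_N2),
        edom f y -> edom f y' -> edom g z ->
        norm2 (grad_y H (y', z) - grad_y H (y, z)) <= L1 * norm2 (y' - y))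
    (lip_z : forall (y : 'rV[R]_N1) (z z' : 'rV[R]_N2),
        edom f y -> edom g z -> edom g z' ->
        norm2 (grad_z H (y, z') - grad_z H (y, z)) <= L2 * norm2 (z' - z))
    (phi : nat -> 'rV[R]_N1 -> R) (psi : nat -> 'rV[R]_N2 -> R)
    (phi_kernel : forall k, kernel_fun (phi k))
    (psi_kernel : forall k, kernel_fun (psi k))
    (y : nat -> 'rV[R]_N1) (z : nat -> 'rV[R]_N2)
    (yz_alg : bregman_altmin f g H phi psi y z) (k : nat) :
  (objective f g H (y k.+1) (z k.+1) <= objective f g H (y k.+1) (z k))%E /\
  (objective f g H (y k.+1) (z k) <= objective f g H (y k) (z k))%E.
Proof.
case: yz_alg => _ _ /(_ k)[ymin zmin].
have [cphi dphi _] := phi_kernel k; have [cpsi dpsi _] := psi_kernel k.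
split; rewrite /objective.
  (* The common term [f (y k.+1)] is split off. Adding it to both sides is monotone in the extended
     reals, so infinite values cause no trouble. *)
  rewrite -!addeA; apply: leeD => //.
  exact: argmin_bregman_le cpsi (dpsi _) zmin.
(* Here the common term is [g (z k)]; the swap matches the order [H + f] of the [y] subproblem. *)
apply: leeD => //; rewrite addeC [leRHS]addeC.
exact: argmin_bregman_le cphi (dphi _) ymin.
Qed.
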